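(* Let $\mathcal{F}$ be a family of relations on a compact normal (Hausdorff) space $X$ such that for every $f\in\mathcal{F}$ the inverse relation $f^{-1}$ is a continuous relation. (a) If $\mathrm{IFS}(X;\mathcal{F})$ is backward minimal and $U\subseteq X$ is a nonempty open set, then there exist $T_1,\dots,T_N\in\mathcal{F}^+$ such that $\bigcup_{n=1}^N T_n(U)=X$. (b) Conversely, if for every nonempty open set $U\subseteq X$ there exist $T_1,\dots,T_N\in\mathcal{F}^+$ such that $\bigcup_{i=1}^N T_i(U)$ is dense in $X$, then $\mathrm{IFS}(X;\mathcal{F})$ is backward minimal.
   Context: A relation $f:X\to Y$ is a subset $f\subseteq X\times Y$; write $f(x)=\{y:(x,y)\in f\}$, $f(A)=\bigcup_{x\in A}f(x)$, and $f^{-1}=\{(y,x):(x,y)\in f\}$, a relation $Y\to X$. Composition of relations is $g\circ f=\{(x,z): \exists y,\ (x,y)\in f,\ (y,z)\in g\}$. A relation $f:X\to Y$ is closed if it is a closed subset of $X\times Y$; it is lower semi-continuous if $f^{-1}(B)$ is open for every open $B\subseteq Y$; it is continuous if it is both closed and lower semi-continuous. For a family $\mathcal{F}$ of relations $X\to X$, $\mathcal{F}^+$ is the semigroup generated by $\mathcal{F}$ under composition (all compositions of finitely many, at least one, elements of $\mathcal{F}$), and $\mathrm{IFS}(X;\mathcal{F})$ denotes the associated iterated function system. The backward orbit of $x$ is $\mathcal{O}^-_{\mathcal{F}}(x)=\bigcup_{h\in\mathcal{F}^+}h^{-1}(x)$. $\mathrm{IFS}(X;\mathcal{F})$ is backward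 minimal if $\overline{\mathcal{O}^-_{\mathcal{F}}(x)}=X$ for every $x\in X$. *)

(* Defs.v *)
From mathcomp Require Import all_boot all_classical all_analysis.

Set Implicit Arguments.
Unset Strict Implicit.
Unset Printing Implicit Defensive.

Local Open Scope classical_set_scope.
Local Open Scope relation_scope.

(* A relation X -> Y is a set (X * Y).  The composite "f then g" is g \; f and
   the inverse relation is f^-1 (relation_scope); f(x) is xsection f x. *)

Definition rel_image {X Y : Type} (f : set (X * Y)) (A : set X) : set Y :=
  \bigcup_(x in A) xsection f x.

Definition lsc_relation {X Y : topologicalType} (f : set (X * Y)) : Prop :=
  forall B : set Y, open B -> open (rel_image f^-1 B).

Definition continuous_relation {X Y : topologicalType} (f : set (X * Y)) : Prop :=
  closed f /\ lsc_relation f.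

Inductive generated_semigroup {X : Type} (F : set (set (X * X))) :
    set (set (X * X)) :=
| generated_base f : F f -> generated_semigroup F f
| generated_comp f g : generated_semigroup F f -> generated_semigroup F g ->
    generated_semigroup F (g \; f).

Definition backward_orbit {X : Type} (F : set (set (X * X))) (x : X) : set X :=
  \bigcup_(h in generated_semigroup F) xsection h^-1 x.

Definition backward_minimal {X : topologicalType} (F : set (set (X * X))) : Prop :=
  forall x : X, closure (backward_orbit F x) = setT.

(* Main.v *)
Require Import Defs.
From HB Require Import structures.
From mathcomp Require Import all_boot finmap all_classical all_analysis.

(** For $T\in\mathcal F^+$, $x\in T(U)$ iff $T^{-1}(x)$ meets $U$.  Since the
    inverses of the generators are lower semi-continuous, $T(U)$ is open for
    open $U$; backward minimality says that these sets cover $X$, and (a) is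
    compactness.  For (b), shrink $U$ to a nonempty open $V$ with
    $\overline V\subseteq U$: the set $\bigcup_i T_i(\overline V)$ is closed,
    because the generators are closed relations on a compact Hausdorff space,
    and dense, so it is $X$, and $\bigcup_i T_i(U) = X$. *)

Local Open Scope classical_set_scope.
Local Open Scope relation_scope.

Lemma rel_imageP {X Y : Type} (f : set (X * Y)) (A : set X) (y : Y) :
  rel_image f A y <-> exists2 x, A x & f (x, y).
Proof. by split=> -[x Ax fxy]; exists x => //; apply/xsectionP. Qed.

Lemma rel_image_comp {X Y Z : Type} (f : set (X * Y)) (g : set (Y * Z))
    (A : set X) : rel_image (g \; f) A = rel_image g (rel_image f A).
Proof.
apply/seteqP; split=> z /rel_imageP.
  move=> [x Ax [y fxy gyz]]; apply/rel_imageP; exists y => //.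
  by apply/rel_imageP; exists x.
move=> [y /rel_imageP[x Ax fxy] gyz]; apply/rel_imageP; exists x => //.
by exists y.
Qed.

Lemma rel_imageS {X Y : Type} (f : set (X * Y)) (A B : set X) :
  A `<=` B -> rel_image f A `<=` rel_image f B.
Proof. exact: bigcup_subset. Qed.

(** The image is the projection to [Y] of the compact set [f^-1] ∩ ([Y] × [A]), and compact subsets
    of the Hausdorff space [Y] are closed. *)
Lemma rel_image_closed {X Y : topologicalType} (f : set (X * Y)) (A : set X) :
  compact [set: X] -> compact [set: Y] -> hausdorff_space Y ->
  closed f^-1 -> closed A -> closed (rel_image f A).
Proof.
move=> cX cY hY cf cA; apply: compact_closed => //.
have -> : rel_image f A = fst @` ([set: Y] `*` A `&` f^-1).
  apply/seteqP; split=> y.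
    by move=> /rel_imageP[x Ax fxy]; exists (y, x).
  by move=> [[y' x] [[_ Ax] fxy] <-]; apply/rel_imageP; exists x.
apply: continuous_compact.
  by apply: continuous_subspaceT => z; exact: cvg_fst.
apply: compact_closedI => //; apply: compact_setX => //.
exact: (subclosed_compact cA cX).
Qed.

(** Turns density of backward orbits into a covering property of the images of [U]. *)
Lemma backward_orbitI {X : Type} (F : set (set (X * X))) (x : X) (U : set X) :
  backward_orbit F x `&` U !=set0 <->
  exists2 h, generated_semigroup F h & rel_image h U x.
Proof.
split=> [[u [[h Fh /xsectionP hux] Uu]]|[h Fh /rel_imageP[u Uu hux]]].
  by exists h => //; apply/rel_imageP; exists u.
by exists u; split=> //; exists h => //; apply/xsectionP.
Qed.

(** Induction on the composite, whose image is an iterated image; applied below to open and to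
    closed sets. *)
Lemma generated_semigroup_image {X : Type} (F : set (set (X * X)))
    (P : set (set X)) :
  (forall f A, F f -> P A -> P (rel_image f A)) ->
  forall h A, generated_semigroup F h -> P A -> P (rel_image h A).
Proof.
move=> PF h A Fh; elim: Fh A => [f Ff A|f g _ Pf _ Pg A PA]; first exact: PF.
by rewrite rel_image_comp; apply/Pg/Pf.
Qed.

(* [compact_cover] needs a pointed space, hence the witness [x0]. *)
Lemma compact_ord_cover {X : topologicalType} (I : Type) (D : set I)
    (U : I -> set X) (x0 : X) :
  compact [set: X] -> (forall i, D i -> open (U i)) ->
  (forall x, exists2 i, D i & U i x) ->
  exists (N : nat) (t : 'I_N.+1 -> I),
    (forall n, D (t n)) /\ \bigcup_(n in [set: 'I_N.+1]) U (t n) = [set: X].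
Proof.
move=> cX oU Ucov.
(* The cover is reindexed by the points of [X], a choice type, unlike [I]. *)
have /choice[i iP] x : exists i, D i /\ U i x.
  by have [i Di Ux] := Ucov x; exists i.
pose pX := HB.pack_for ptopologicalType X (isPointed.Build X x0).
have : @cover_compact pX [set: X] by rewrite -compact_cover.
move=> /(_ X [set: X] (U \o i)) [x _||s _ scov].
- by apply: oU; have [] := iP x.
- by move=> x _; exists x => //; have [] := iP x.
(* The one index beyond [s] yields the default [x0], and [i x0] also lies in [D]. *)
exists (size s), (fun n => i (nth x0 s n)); split=> [n|].
  by have [] := iP (nth x0 s n).
apply/seteqP; split=> // x _; have [y /= ys Uy] := scov x Logic.I.
have ltN : (index y s < (size s).+1)%N by rewrite ltnS index_size.
by exists (Ordinal ltN) => //=; rewrite nth_index.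
Qed.

(** Compact Hausdorff spaces are regular. *)
Lemma compact_hausdorff_open_shrink {X : topologicalType} (U : set X) :
  compact [set: X] -> hausdorff_space X -> open U -> U !=set0 ->
  exists V : set X, [/\ open V, V !=set0 & closure V `<=` U].
Proof.
move=> cX hX oU [u Uu].
have nU : nbhs u U by apply: open_nbhs_nbhs.
have [V nV VU] := @compact_regular X u setT hX cX filterT U nU.
exists V^°; split; first exact: open_interior.
  by exists u; exact: nV.
by apply: subset_trans VU; apply: closureS; exact: interior_subset.
Qed.

Theorem proposition2p4 (X : topologicalType)
    (cptX : compact [set: X]) (normX : normal_space X) (hausX : hausdorff_space X)
    (F : set (set (X * X)))
    (Fcont : forall f : set (X * X), F f -> continuous_relation f^-1) :
  (backward_minimal F ->
     forall U : set X, open U -> U !=set0 ->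
     exists (N : nat) (T : 'I_N.+1 -> set (X * X)),
       (forall n : 'I_N.+1, generated_semigroup F (T n)) /\
       \bigcup_(n in [set: 'I_N.+1]) rel_image (T n) U = [set: X])
  /\
  ((forall U : set X, open U -> U !=set0 ->
     exists (N : nat) (T : 'I_N.+1 -> set (X * X)),
       (forall n : 'I_N.+1, generated_semigroup F (T n)) /\
       dense (\bigcup_(n in [set: 'I_N.+1]) rel_image (T n) U)) ->
   backward_minimal F).
Proof.
split=> [minF U oU [u Uu]|denseF x].
  apply: (@compact_ord_cover _ _ _ (rel_image^~ U) u) => // [h Fh|x].
    apply: (generated_semigroup_image _ open) Fh oU => f A /Fcont[_ lf] oA.
    (* Lower semi-continuity of [f^-1] concerns images under its inverse, which is [f]. *)
    have -> : f = (f^-1)^-1 by apply/seteqP; split=> -[].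
    exact: lf.
  apply/backward_orbitI.
  have : closure (backward_orbit F x) u by rewrite minF.
  by move=> /(_ U); apply; exact: open_nbhs_nbhs.
apply/seteqP; split=> // y _ B; rewrite nbhsE => -[U [oU Uy] UB].
have [V [oV V0 VU]] :
    exists V : set X, [/\ open V, V !=set0 & closure V `<=` U].
  by apply: compact_hausdorff_open_shrink => //; exists y.
suff [z [xz Uz]] : backward_orbit F x `&` U !=set0.
  by exists z; split=> //; exact: UB.
apply/backward_orbitI; have [N [T [FT dT]]] := denseF V oV V0.
pose C := \bigcup_(n in [set: 'I_N.+1]) rel_image (T n) (closure V).
have cC : closed C.
  apply: closed_bigcup => [|n _]; first exact: finite_finset.
  apply: (generated_semigroup_image _ closed) (FT n) (@closed_closure _ V).
  by move=> f A /Fcont[cf _]; exact: rel_image_closed.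
have [n _ Tnx] : C x.
  (* Otherwise the nonempty open complement of [C] would meet the dense union of the [T n] images of
     [V], which lies in [C]. *)
  apply: contrapT => nCx.
  have [z [nCz [n _ Tnz]]] : ~` C `&`
      \bigcup_(n in [set: 'I_N.+1]) rel_image (T n) V !=set0.
    by apply: dT; [exists x|exact: closed_openC].
  by apply: nCz; exists n => //; apply: rel_imageS Tnz; exact: subset_closure.
by exists (T n) => //; apply: rel_imageS Tnx.
Qed.
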